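(* Let $G$ be a discrete group, $\omega_0$ a normalized $\mathbb{C}$-valued $2$-cocycle on $G$, $t\in[0,1]$, $\omega^t=e^{t\omega_0}$, and $x\in G$ an element of finite order. Let $\xi:G\to\mathbb{C}$ be a function with $\omega_0(g,h)+\xi(gh)=\omega_0(h,g)+\xi(hg)$ whenever $gh\in\mathrm{Ad}_G(x)$. Let $A$ be a unital $G$-graded $\mathbb{C}$-algebra. Then, for every $n$, the map $\phi\mapsto\phi^{(t)}$ is a linear isomorphism from $HC^n(A)_x$ to $HC^n(A_{\omega^t})_x$.
   Context: Normalized $2$-cocycle: $\omega_0(h,k)+\omega_0(g,hk)=\omega_0(g,h)+\omega_0(gh,k)$ and $\omega_0(e,g)=\omega_0(g,e)=\omega_0(g,g^{-1})=0$. $\mathrm{Ad}_G(x)$ is the conjugacy class of $x$. A $G$-graded algebra is $A=\bigoplus_{g}A_g$ with $1\in A_e$, $A_gA_h\subset A_{gh}$. $A_{\omega^t}$ is the space $A$ with product $a*b=\omega^t(g,h)ab$ for $a\in A_g,b\in A_h$; it is again $G$-graded. Cyclic $n$-cocycles are functionals $\phi$ on $A^{\otimes n+1}$ with $\phi(a_n,a_0,\dots,a_{n-1})=(-1)^n\phi(a_0,\dots,a_n)$ and $\phi\circ b=0$, where $b(a_0\otimes\cdots\otimes a_n)=\sum_{i=0}^{n-1}(-1)^ia_0\otimes\cdots\otimes a_ia_{i+1}\otimes\cdots\otimes a_n+(-1)^na_na_0\otimes a_1\otimes\cdots\otimes a_{n-1}$; $HC^n$ is the cohomology of the complex of functionals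 with this cyclic invariance. $HC^n(A)_x$ is the direct factor given by the subcomplex of functionals supported on the conjugacy class of $x$, i.e. vanishing on $(a_0,\dots,a_n)$ with $a_i\in A_{g_i}$ and $g_0\cdots g_n\notin\mathrm{Ad}_G(x)$. For such $\phi$ and homogeneous $a_i\in A_{g_i}$ with $g_0\cdots g_n\in\mathrm{Ad}_G(x)$, $$\phi^{(t)}(a_0,\dots,a_n)=\omega^t(g_0,g_1)\,\omega^t(g_0g_1,g_2)\cdots\omega^t(g_0\cdots g_{n-1},g_n)\,e^{t\xi(g_0\cdots g_n)}\phi(a_0,\dots,a_n),$$ and $\phi^{(t)}$ is zero on the other homogeneous tuples. *)

(* Defs.v *)
From HB Require Import structures.
From mathcomp Require Import all_boot all_order all_algebra.
From mathcomp Require Import all_classical reals sequences exp trigo.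
From mathcomp Require Import finmap complex ring.

Set Implicit Arguments.
Unset Strict Implicit.
Unset Printing Implicit Defensive.

Import GRing.Theory Num.Theory.

Local Open Scope classical_set_scope.
Local Open Scope ring_scope.
Local Open Scope complex_scope.
Local Open Scope quotient_scope.

(* The zero algebra is allowed, which [algType] and [lalgType] exclude. *)
HB.mixin Record isUnitalAlg (K : pzRingType) A of GRing.Lmodule K A := {
  amul : A -> A -> A;
  aone : A;
  amulA : associative amul;
  amul1r : left_id aone amul;
  amulr1 : right_id aone amul;
  amul_linl : forall (c : K) (u v w : A),
    amul (c *: u + v) w = c *: amul u w + amul v w;
  amul_linr : forall (c : K) (u v w : A),
    amul w (c *: u + v) = c *: amul w u + amul w v
}.

#[short(type="unitalAlgType")]
HB.structure Definition UnitalAlg (K : pzRingType) :=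
  {A of isUnitalAlg K A & GRing.Lmodule K A}.

Local Notation "u ** v" := (amul u v) (at level 40, left associativity).

(* [f] is a decomposition of [a] along the family [V]; the \sum_(_ \in setT)
   below is the sum of a finitely supported family. *)
Definition is_decomposition (I : choiceType) (M : nmodType) (V : I -> set M)
    (a : M) (f : I -> M) : Prop :=
  [/\ forall i, V i (f i), finite_set [set i | f i != 0] &
      a = \sum_(i \in [set: I]) f i].

HB.mixin Record isGraded (G : groupType) (K : pzRingType) A
    of UnitalAlg K A := {
  homog : G -> set A;
  homog0 : forall g, homog g 0;
  homogP : forall g (c : K) (u v : A),
    homog g u -> homog g v -> homog g (c *: u + v);
  homog1 : homog 1%g aone;
  homogM : forall (g h : G) (u v : A),
    homog g u -> homog h v -> homog (g * h)%g (u ** v);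
  homog_direct : forall a, exists! f, is_decomposition homog a f
}.

#[short(type="gradedAlgType")]
HB.structure Definition GradedAlg (G : groupType) (K : pzRingType) :=
  {A of isGraded G K A & UnitalAlg K A}.

Arguments homogM {G K s g h u v}.

Definition Ad (G : groupType) (x : G) : set G := [set (x ^ h)%g | h in [set: G]].

Definition finite_order (G : groupType) (x : G) : Prop :=
  exists2 k : nat, (0 < k)%N & (x ^+ k = 1)%g.

Record normalized_cocycle (G : groupType) (M : zmodType) (w : G -> G -> M)
    : Prop := NormalizedCocycle {
  cocycleE : forall g h k, w h k + w g (h * k)%g = w g h + w (g * h)%g k;
  cocycle1g : forall g, w 1%g g = 0;
  cocycleg1 : forall g, w g 1%g = 0;
  cocyclegV : forall g, w g (g^-1)%g = 0
}.

Definition cexp (R : realType) (z : R[i]) : R[i] :=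
  let: a +i* b := z in (expR a * cos b) +i* (expR a * sin b).

Definition expcocycle (R : realType) (G : groupType) (w : G -> G -> R[i])
  (t : R) (g h : G) : R[i] := cexp (t%:C * w g h).

Section Exp.
Context (R : realType).
Lemma cexp0 : cexp (0 : R[i]) = 1.
Proof. by rewrite /cexp/= expR0 cos0 sin0 mulr1 mulr0. Qed.

Lemma cexpD (a b : R[i]) : cexp (a + b) = cexp a * cexp b.
Proof.
case: a b => [a1 a2] [b1 b2]; rewrite /cexp/= expRD cosD sinD.
by congr (_ +i* _); ring.
Qed.

Context (G : groupType) (w : G -> G -> R[i]).
Hypothesis hw : normalized_cocycle w.
Variable t : R.

Lemma expcocycle1g g : expcocycle w t 1%g g = 1.
Proof. by rewrite /expcocycle (cocycle1g hw) mulr0 cexp0. Qed.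
Lemma expcocycleg1 g : expcocycle w t g 1%g = 1.
Proof. by rewrite /expcocycle (cocycleg1 hw) mulr0 cexp0. Qed.
Lemma expcocycleE g h k : expcocycle w t h k * expcocycle w t g (h * k)%g =
  expcocycle w t g h * expcocycle w t (g * h)%g k.
Proof. by rewrite /expcocycle -!cexpD -!mulrDr (cocycleE hw). Qed.
End Exp.

Section Homog.
Context (G : groupType) (K : pzRingType) (A : gradedAlgType G K).
Implicit Types (a b u v : A) (g h : G).

Lemma amul0l u : (0 : A) ** u = 0.
Proof.
by rewrite -[in LHS](addNr u) -scaleN1r amul_linl scaleN1r addNr.
Qed.

Lemma amul0r u : u ** (0 : A) = 0.
Proof.
by rewrite -[in LHS](addNr u) -scaleN1r amul_linr scaleN1r addNr.
Qed.

Lemma amulZl c u v : (c *: u) ** v = c *: (u ** v).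
Proof. by rewrite -[c *: u]addr0 amul_linl amul0l addr0. Qed.

Lemma amulZr c u v : u ** (c *: v) = c *: (u ** v).
Proof. by rewrite -[c *: v]addr0 amul_linr amul0r addr0. Qed.

Lemma homogZ g c u : homog g u -> homog g (c *: u).
Proof.
by move=> gu; rewrite -[c *: u]addr0; apply: homogP => //; exact: homog0.
Qed.

Lemma finite_supp_lin (I : Type) (c : K) (F F' : I -> A) :
  finite_set [set i | F i != 0] -> finite_set [set i | F' i != 0] ->
  finite_set [set i | c *: F i + F' i != 0].
Proof.
move=> fF fF'.
apply: (@sub_finite_set _ _ ([set i | F i != 0] `|` [set i | F' i != 0])).
  move=> i /=; have [->|] := eqVneq (F i) 0; last by left.
  by rewrite scaler0 add0r; right.
by rewrite finite_setU.
Qed.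

Lemma fsum_lin (I : choiceType) (c : K) (F F' : I -> A) :
  finite_set [set i | F i != 0] -> finite_set [set i | F' i != 0] ->
  \sum_(i \in [set: I]) (c *: F i + F' i) =
  c *: (\sum_(i \in [set: I]) F i) + \sum_(i \in [set: I]) F' i.
Proof.
move=> /finite_fsetP[s sE] /finite_fsetP[s' sE'].
have sub i : i \notin (s `|` s')%fset -> F i = 0 /\ F' i = 0.
  rewrite in_fsetU negb_or => /andP[si s'i]; split; apply/eqP.
  - by apply: contraNT si => Fi; have : [set i | F i != 0] i by []; rewrite sE.
  - by apply: contraNT s'i => Fi;
      have : [set i | F' i != 0] i by []; rewrite sE'.
rewrite !(fsbigTE (s `|` s')%fset); try by move=> i /sub[].
  by rewrite big_split/= scaler_sumr.
by move=> i /sub[-> ->]; rewrite scaler0 addr0.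
Qed.

(* [hcomp a g] is the component of degree [g] of [a]. *)
Definition hcomp a : G -> A := projT1 (cid (@homog_direct G K A a)).

Lemma hcompP a : is_decomposition homog a (hcomp a).
Proof. by rewrite /hcomp; case: cid => f []. Qed.

Lemma hcomp_uniq a f : is_decomposition homog a f -> hcomp a = f.
Proof. by rewrite /hcomp; case: cid => f' [fd fu] /fu. Qed.

Lemma hcomp_lin c a b :
  hcomp (c *: a + b) = fun g => c *: hcomp a g + hcomp b g.
Proof.
have [ha fa aE] := hcompP a; have [hb fb bE] := hcompP b.
apply: hcomp_uniq; split.
- by move=> i; exact: homogP.
- exact: finite_supp_lin.
- by rewrite fsum_lin// -aE -bE.
Qed.

Lemma hcomp_homog a g :
  homog g a -> hcomp a = (fun h => if h == g then a else 0).
Proof.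
move=> ga; apply: hcomp_uniq; split.
- by move=> h; case: eqP => [->//|_]; exact: homog0.
- apply: (@sub_finite_set _ _ [set g]) => // h /=.
  by case: (h =P g) => //; rewrite eqxx.
- rewrite (fsbigTE [fset g]%fset) => [|h]; last by rewrite inE => /negPf ->.
  by rewrite big_seq_fset1 eqxx.
Qed.

Lemma homog_ind (P : A -> Prop) :
  P 0 -> (forall c a b, P a -> P b -> P (c *: a + b)) ->
  (forall g a, homog g a -> P a) -> forall a, P a.
Proof.
move=> P0 PD Ph a; have [ha fa ->] := hcompP a.
apply: big_ind => // [u v Pu Pv|g _]; last exact: Ph.
by rewrite -[u]scale1r; exact: PD.
Qed.

End Homog.

Section Twist.
Context (R : realType) (G : groupType) (w : G -> G -> R[i]).
Context (hw : normalized_cocycle w) (t : R).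

(* A_(w^t): same space and same grading as A, with product [twist_mul] below,
   characterized by [twist_mulE]. *)
Definition twist of normalized_cocycle w & R :=
  fun A : gradedAlgType G R[i] => A : Type.

Context (A : gradedAlgType G R[i]).
Implicit Types (a b c : A) (g h : G).
Local Notation W := (expcocycle w t).

Definition twist_mul a b : A :=
  \sum_(p \in [set: G * G]) W p.1 p.2 *: (hcomp a p.1 ** hcomp b p.2).

Let twist_fin a b : finite_set
  [set p : G * G | W p.1 p.2 *: (hcomp a p.1 ** hcomp b p.2) != 0].
Proof.
have [_ fa _] := hcompP a; have [_ fb _] := hcompP b.
apply: sub_finite_set (finite_setX fa fb) => -[g h] /= /eqP ab0.
by split; apply/eqP => ab; apply: ab0; rewrite ab ?amul0l ?amul0r scaler0.
Qed.

Lemma twist_mul_linl (k : R[i]) a b c :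
  twist_mul (k *: a + b) c = k *: twist_mul a c + twist_mul b c.
Proof.
rewrite /twist_mul -fsum_lin//; apply: eq_fsbigr => -[g h] _ /=.
by rewrite hcomp_lin amul_linl scalerDr !scalerA mulrC.
Qed.

Lemma twist_mul_linr (k : R[i]) a b c :
  twist_mul c (k *: a + b) = k *: twist_mul c a + twist_mul c b.
Proof.
rewrite /twist_mul -fsum_lin//; apply: eq_fsbigr => -[g h] _ /=.
by rewrite hcomp_lin amul_linr scalerDr !scalerA mulrC.
Qed.

Lemma twist_mulE g h a b :
  homog g a -> homog h b -> twist_mul a b = W g h *: (a ** b).
Proof.
move=> ga hb; rewrite /twist_mul (hcomp_homog ga) (hcomp_homog hb).
rewrite (fsbigTE [fset (g, h)]%fset).
  by rewrite big_seq_fset1/= !eqxx.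
move=> [g' h']; rewrite inE xpair_eqE /=.
by case: eqP; case: eqP; rewrite ?amul0l ?amul0r ?scaler0.
Qed.

Let twist_mul0l a : twist_mul 0 a = 0.
Proof.
by rewrite -[in LHS](addNr 0) -scaleN1r twist_mul_linl scaleN1r addNr.
Qed.

Let twist_mul0r a : twist_mul a 0 = 0.
Proof.
by rewrite -[in LHS](addNr 0) -scaleN1r twist_mul_linr scaleN1r addNr.
Qed.

Lemma twist_mulA : associative twist_mul.
Proof.
elim/homog_ind => [b c|k a a' IH IH' b c|g a ga].
- by rewrite !twist_mul0l.
- by rewrite !twist_mul_linl IH IH'.
elim/homog_ind => [c|k b b' IH IH' c|h b hb].
- by rewrite twist_mul0l !twist_mul0r twist_mul0l.
- by rewrite !(twist_mul_linl, twist_mul_linr) IH IH'.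
elim/homog_ind => [|k c c' IH IH'|l c lc].
- by rewrite !twist_mul0r.
- by rewrite !twist_mul_linr IH IH'.
rewrite (twist_mulE hb lc) (twist_mulE ga hb).
rewrite (twist_mulE ga (homogZ _ (homogM hb lc))).
rewrite (twist_mulE (homogZ _ (homogM ga hb)) lc).
by rewrite amulZl amulZr !scalerA amulA [in LHS]mulrC expcocycleE// mulrC.
Qed.

Lemma twist_mul1r : left_id (aone : A) twist_mul.
Proof.
elim/homog_ind => [|k a b IH IH'|g a ga].
- exact: twist_mul0r.
- by rewrite twist_mul_linr IH IH'.
by rewrite (twist_mulE (@homog1 _ _ A) ga) expcocycle1g// scale1r amul1r.
Qed.

Lemma twist_mulr1 : right_id (aone : A) twist_mul.
Proof.
elim/homog_ind => [|k a b IH IH'|g a ga].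
- exact: twist_mul0l.
- by rewrite twist_mul_linl IH IH'.
by rewrite (twist_mulE ga (@homog1 _ _ A)) expcocycleg1// scale1r amulr1.
Qed.

Lemma twist_homogM g h a b :
  homog g a -> homog h b -> homog (g * h)%g (twist_mul a b).
Proof.
by move=> ga hb; rewrite (twist_mulE ga hb); apply: homogZ; exact: homogM.
Qed.

HB.instance Definition _ := GRing.Lmodule.on (twist hw t A).
HB.instance Definition _ := isUnitalAlg.Build R[i] (twist hw t A)
  twist_mulA twist_mul1r twist_mulr1 twist_mul_linl twist_mul_linr.
HB.instance Definition _ := isGraded.Build G R[i] (twist hw t A)
  (@homog0 G R[i] A) (@homogP G R[i] A) (@homog1 G R[i] A) twist_homogM
  (@homog_direct G R[i] A).

End Twist.

Section LmodQuotient.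
Context (K : pzRingType) (V : lmodType K) (S : {pred V}).

Definition submodule of submod_closed S : {pred V} := S.

Context (hS : submod_closed S).

HB.instance Definition _ := GRing.isSubmodClosed.Build K V (submodule hS) hS.

(* V / S as a left module; the library only provides the additive group. *)
Definition lmod_quot := Quotient.quot (submodule hS).

HB.instance Definition _ :=
  ZmodQuotient.copy lmod_quot (Quotient.quot (submodule hS)).

Local Notation Q := lmod_quot.

Definition quot_scale (c : K) (u : Q) : Q := \pi_Q (c *: repr u).

Lemma pi_scale c (v : V) : \pi_Q (c *: v) = quot_scale c (\pi_Q v).
Proof.
apply/eqP; rewrite /quot_scale -Quotient.idealrBE -scalerBr rpredZ//.
by rewrite Quotient.idealrBE reprK.
Qed.

Let quot_scaleA a b v : quot_scale a (quot_scale b v) = quot_scale (a * b) v.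
Proof. by elim/quotW: v => v; rewrite -(pi_scale b v) -!(pi_scale _ _) scalerA. Qed.

Let quot_scale1 : left_id 1 quot_scale.
Proof. by elim/quotW => v; rewrite -pi_scale scale1r. Qed.

Let quot_scaleDr : right_distributive quot_scale +%R.
Proof.
move=> a; elim/quotW => u; elim/quotW => v.
by rewrite -raddfD -!pi_scale scalerDr raddfD.
Qed.

Let quot_scaleDl v : {morph quot_scale^~ v : a b / a + b}.
Proof. by elim/quotW: v => v a b; rewrite -!pi_scale scalerDl raddfD. Qed.

HB.instance Definition _ := GRing.Zmodule_isLmodule.Build K Q
  quot_scaleA quot_scale1 quot_scaleDr quot_scaleDl.

End LmodQuotient.

Section CyclicCohomology.
Context (G : groupType) (K : fieldType) (A : gradedAlgType G K) (x : G).

(* The linear functionals on the n-th tensor power of A are represented by the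
   multilinear maps on A^n. *)
Definition multilinear n (phi : ('I_n -> A) -> K) : Prop :=
  forall (a : 'I_n -> A) (i : 'I_n) (c : K) (u v : A),
    phi [eta a with i |-> c *: u + v] =
    c * phi [eta a with i |-> u] + phi [eta a with i |-> v].

(* [a \o ord_pred] is (a_n, a_0, ..., a_(n-1)). *)
Definition cyclic n (phi : ('I_n.+1 -> A) -> K) : Prop :=
  forall a, phi (a \o @ord_pred n.+1) = (-1) ^+ n * phi a.

(* Vanishing away from the conjugacy class of x. *)
Definition supported n (phi : ('I_n.+1 -> A) -> K) : Prop :=
  forall (g : 'I_n.+1 -> G) (a : 'I_n.+1 -> A),
    (forall i, homog (g i) (a i)) ->
    ~ Ad x (\prod_(i < n.+1) g i)%g -> phi a = 0.

Definition cochain n (phi : ('I_n.+1 -> A) -> K^o) : Prop :=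
  [/\ multilinear phi, cyclic phi & supported phi].

(* (a_0, ..., a_i a_(i+1), ..., a_(n+1)) *)
Definition face n (i : 'I_n.+1) (a : 'I_n.+2 -> A) : 'I_n.+1 -> A := fun j =>
  if (j < i)%N then a (widen_ord (leqnSn _) j)
  else if j == i then a (widen_ord (leqnSn _) i) ** a (lift ord0 i)
  else a (lift ord0 j).

(* (a_(n+1) a_0, a_1, ..., a_n) *)
Definition last_face n (a : 'I_n.+2 -> A) : 'I_n.+1 -> A := fun j =>
  if j == ord0 then a ord_max ** a ord0 else a (widen_ord (leqnSn _) j).

(* phi \o b *)
Definition hochschild n (phi : ('I_n.+1 -> A) -> K^o) :
    ('I_n.+2 -> A) -> K^o :=
  fun a => \sum_(i < n.+1) (-1) ^+ i * phi (face i a)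
           + (-1) ^+ n.+1 * phi (last_face a).

Definition is_cocycle n : {pred ('I_n.+1 -> A) -> K^o} :=
  fun phi => `[< cochain phi /\ hochschild phi = 0 >].

Definition is_coboundary n : (('I_n.+1 -> A) -> K^o) -> Prop :=
  match n with
  | 0 => fun phi => phi = 0
  | m.+1 => fun phi =>
      exists2 psi : ('I_m.+1 -> A) -> K^o, cochain psi & phi = hochschild psi
  end.

Lemma cochain_submod n : [/\ cochain (0 : ('I_n.+1 -> A) -> K^o) &
  forall c (phi psi : ('I_n.+1 -> A) -> K^o),
    cochain phi -> cochain psi -> cochain (c *: phi + psi)].
Proof.
split=> [|c phi psi [mp cp sp] [mq cq sq]]; split.
- by move=> a i c u v; rewrite mulr0 addr0.
- by move=> a; rewrite mulr0.
- by [].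
- move=> a i d u v; rewrite !fctE mp mq /GRing.scale/=; ring.
- by move=> a; rewrite !fctE cp cq /GRing.scale/=; ring.
- move=> g a ga gx; rewrite !fctE (sp g)// (sq g)//.
  by rewrite scaler0 addr0.
Qed.

Lemma hochschild_lin n c (phi psi : ('I_n.+1 -> A) -> K^o) :
  hochschild (c *: phi + psi) = c *: hochschild phi + hochschild psi.
Proof.
apply/funext => a; rewrite /hochschild !fctE scalerDr scaler_sumr.
rewrite addrACA -big_split/=; congr (_ + _).
  by apply: eq_bigr => i _; rewrite /GRing.scale/=; ring.
by rewrite /GRing.scale/=; ring.
Qed.

Lemma hochschild0 n : hochschild (0 : ('I_n.+1 -> A) -> K^o) = 0.
Proof.
by apply: (addrI (hochschild 0)); rewrite addr0 -{1}[hochschild 0]scale1r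
  -hochschild_lin scale1r addr0.
Qed.

Lemma is_cocycle_submod n : submod_closed (@is_cocycle n).
Proof.
have [c0 cP] := cochain_submod n; split=> [|c phi psi].
  by apply/asboolP; split=> //; exact: hochschild0.
move=> /asboolP[cphi phi0] /asboolP[cpsi psi0]; apply/asboolP; split.
  exact: cP.
by rewrite hochschild_lin phi0 psi0 scaler0 addr0.
Qed.

HB.instance Definition _ n := GRing.isSubmodClosed.Build K _ (@is_cocycle n)
  (is_cocycle_submod n).

Record cocycle n := Cocycle {
  cocycle_val :> ('I_n.+1 -> A) -> K^o;
  _ : cocycle_val \in @is_cocycle n
}.

HB.instance Definition _ n := [isSub for @cocycle_val n].
HB.instance Definition _ n := [Choice of cocycle n by <:].
HB.instance Definition _ n := [SubChoice_isSubLmodule of cocycle n by <:].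

(* Among the cocycles, those that are [hochschild psi] for some cochain [psi];
   the quotient below is thus ker / im without using hochschild \o hochschild = 0. *)
Definition coboundary n : {pred cocycle n} :=
  fun phi => `[< is_coboundary (phi : ('I_n.+1 -> A) -> K^o) >].

Lemma coboundary_submod n : submod_closed (@coboundary n).
Proof.
case: n => [|n]; split=> [|c phi psi].
- exact/asboolP.
- move=> /asboolP/= phi0 /asboolP/= psi0; apply/asboolP => /=.
  by rewrite phi0 psi0 scaler0 addr0.
- apply/asboolP; exists 0; last by rewrite hochschild0.
  by have [] := cochain_submod n.
- move=> /asboolP[phi' cphi phiE] /asboolP[psi' cpsi psiE]; apply/asboolP.
  exists (c *: phi' + psi'); first by have [_] := cochain_submod n; apply.
  by rewrite hochschild_lin -phiE -psiE.
Qed.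

(* HC^n(A)_x *)
Definition HC n := lmod_quot (coboundary_submod n).

Definition HC_class n (phi : cocycle n) : HC n := \pi_(HC n) phi.

End CyclicCohomology.

Section Deformation.
Context (R : realType) (G : groupType) (w : G -> G -> R[i]).
Context (t : R) (xi : G -> R[i]) (x : G).

(* w^t(g_0, g_1) w^t(g_0 g_1, g_2) ... w^t(g_0 ... g_(n-1), g_n)
   e^(t xi(g_0 ... g_n)) *)
Definition deform_weight n (g : 'I_n.+1 -> G) : R[i] :=
  (\prod_(i < n)
     expcocycle w t (\prod_(j < n.+1 | (j <= i)%N) g j)%g (g (lift ord0 i)))
  * cexp (t%:C * xi (\prod_(i < n.+1) g i)%g).

(* [psi] is phi^(t). The formula is imposed on homogeneous tuples only, which
   determines a multilinear [psi], see [is_deformation_uniq] below. *)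
Definition is_deformation (A : gradedAlgType G R[i]) n
    (phi psi : ('I_n.+1 -> A) -> R[i]) : Prop :=
  forall (g : 'I_n.+1 -> G) (a : 'I_n.+1 -> A),
    (forall i, homog (g i) (a i)) ->
    psi a = if `[< Ad x (\prod_(i < n.+1) g i)%g >]
            then deform_weight g * phi a else 0.

Lemma is_deformation_uniq (A : gradedAlgType G R[i]) n
    (phi psi psi' : ('I_n.+1 -> A) -> R[i]) :
  multilinear psi -> multilinear psi' ->
  is_deformation phi psi -> is_deformation phi psi' -> psi = psi'.
Proof.
move=> lin lin' def def'; apply/funext => a.
have lin0 f : multilinear f -> forall b i, f [eta b with i |-> 0] = 0 :> R[i].
  by move=> flin b i; have := flin b i (-1) 0 0;
    rewrite scaler0 addr0 mulN1r addNr.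
suff H k : forall b : 'I_n.+1 -> A,
    (forall i : 'I_n.+1, (k <= i)%N -> exists g, homog g (b i)) ->
    psi b = psi' b.
  by apply: (H n.+1) => i; rewrite leqNgt ltn_ord.
elim: k => [|k IH] b hb.
  have /choice[g hg] : forall i, exists g, homog g (b i) by move=> i; exact: hb.
  by rewrite (def g b hg) (def' g b hg).
have [kn|nk] := ltnP k n.+1; last first.
  by apply: IH => i ki; have := leq_ltn_trans (leq_trans nk ki) (ltn_ord i);
    rewrite ltnn.
pose ik := Ordinal kn.
suff Hu u : psi [eta b with ik |-> u] = psi' [eta b with ik |-> u].
  have -> : b = [eta b with ik |-> b ik] :> ('I_n.+1 -> A).
    by apply/funext => i /=; case: eqP => [->|].
  exact: Hu.
elim/homog_ind: u => [|c u v Hu Hv|g u gu].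
- by rewrite !lin0.
- by rewrite lin lin' Hu Hv.
apply: IH => i ki /=; case: eqP => [_|/eqP ni]; first by exists g.
by apply: hb; rewrite ltn_neqAle ki eq_sym andbT.
Qed.

End Deformation.

(* Main.v *)
Require Import Defs.
From HB Require Import structures.
From mathcomp Require Import all_boot all_order all_algebra.
From mathcomp Require Import all_classical reals complex.
From mathcomp Require Import finmap ring.

Import GRing.Theory Num.Theory.

Set Implicit Arguments.
Unset Strict Implicit.
Unset Printing Implicit Defensive.

Local Open Scope ring_scope.
Local Open Scope quotient_scope.

(** The deformation is already an isomorphism of complexes, so that no
homotopy is involved.  Its weight on degrees (g_0, ..., g_n) is the exponential
of t times the exponent
  E(g) = sum_k w(g_0 ... g_(k-1), g_k) + xi(g_0 ... g_n),
the term k = 0 being w(1, g_0) = 0 ([deform_weightE]).  Two identities for E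
carry the proof.  The cocycle identity shows that multiplying two neighbouring
entries of g lowers E by w of these entries ([exponent_gface]); this is exactly
the factor by which the product of A_(w^t) differs from that of A.  The cocycle
identity, telescoped, and the hypothesis on xi show that E is invariant under
cyclic rotation as soon as g_0 ... g_n is in the conjugacy class of x
([exponent_rot]).  Hence phi^(t) is cyclic when phi is, and the deformation
commutes with the Hochschild coboundaries ([hochschild_deform]); the last face
needs no separate treatment, being the first face after a rotation
([last_faceE]).

A multilinear functional supported on the class is determined by its values on
homogeneous tuples, and there the weights for the parameters s and t multiply
to the weight for s + t.  So the deformation with parameter -t is a
two-sided inverse ([deformNK]), and its compatibility with the coboundaries is
a formal consequence ([hochschild_undeform]).  Passing to the quotients
cocycles / coboundaries gives the linear isomorphism in cohomology.

As A_(w^t) has the same underlying space and grading as A, functionals on both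
algebras are the same functions; being multilinear, cyclic or supported is the
same property for both, and only the coboundary tells the algebras apart. *)

(** * The exponent of the deformation weight *)

Section Exponent.
Context (G : groupType) (M : zmodType) (w : G -> G -> M) (xi : G -> M).

(** The sum of the w(p g_0 ... g_(k-1), g_k).  The starting point p makes
inductions on the word possible. *)
Fixpoint path_cocycle (p : G) (s : seq G) : M :=
  if s is g :: s' then w p g + path_cocycle (p * g)%g s' else 0.

Definition exponent m (g : 'I_m -> G) : M :=
  path_cocycle 1%g (codom g) + xi (\prod_(i < m) g i)%g.

(** The degrees of [face i a] when those of a are g; written with the same case
distinction as [face], so that [homog_face] holds entry by entry. *)
Definition gface n (i : 'I_n.+1) (g : 'I_n.+2 -> G) : 'I_n.+1 -> G := fun j =>
  if (j < i)%N then g (widen_ord (leqnSn _) j)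
  else if j == i then (g (widen_ord (leqnSn _) i) * g (lift ord0 i))%g
  else g (lift ord0 j).

Lemma codomSl m (g : 'I_m.+1 -> G) :
  codom g = g ord0 :: codom (g \o lift ord0).
Proof. by rewrite !codomE enum_ordSl /= -map_comp. Qed.

Lemma codomSSl m (g : 'I_m.+2 -> G) : codom g =
  g ord0 :: g (lift ord0 ord0) :: codom (g \o lift ord0 \o lift ord0).
Proof. by rewrite codomSl (codomSl (g \o lift ord0)). Qed.

Lemma codomSr m (g : 'I_m.+1 -> G) :
  codom g = rcons (codom (g \o widen_ord (leqnSn m))) (g ord_max).
Proof. by rewrite !codomE enum_ordSr map_rcons -map_comp. Qed.

Lemma prod_codom m (g : 'I_m -> G) :
  (\prod_(h <- codom g) h)%g = (\prod_(i < m) g i)%g.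
Proof.
by rewrite codomE big_map enumT [index_enum _]unlock.
Qed.

Lemma path_cocycle_sum p m (g : 'I_m -> G) :
  path_cocycle p (codom g) =
  \sum_(i < m) w (p * \prod_(j < m | (j < i)%N) g j)%g (g i).
Proof.
elim: m p g => [|m IH] p g; first by rewrite big_ord0 codomE enum_ord0.
rewrite codomSl /= IH big_ord_recl big_pred0// mulg1; congr (_ + _).
apply: eq_bigr => i _ /=; congr (w _ _).
rewrite [in RHS]big_mkcond big_ord_recl/= -mulgA; congr (_ * (_ * _))%g.
by rewrite big_mkcond.
Qed.

Lemma codom_gface0 n (g : 'I_n.+2 -> G) : codom (gface ord0 g) =
  (g ord0 * g (lift ord0 ord0))%g :: codom (g \o lift ord0 \o lift ord0).
Proof.
rewrite codomSl; congr (_ :: _).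
by rewrite /gface ltnn eqxx; congr (g _ * _)%g; apply/val_inj.
Qed.

Lemma codom_gface_lift n (i : 'I_n.+1) (g : 'I_n.+3 -> G) :
  codom (gface (lift ord0 i) g) = g ord0 :: codom (gface i (g \o lift ord0)).
Proof.
rewrite codomSl; congr (_ :: _).
  by rewrite /gface ltn0Sn; congr g; apply/val_inj.
congr codom; apply/funext => j.
rewrite /gface /comp !lift0 ltnS (inj_eq lift_inj).
case: ifP => _; first by congr g; apply/val_inj.
by case: ifP => _ //; congr (g _ * _)%g; apply/val_inj.
Qed.

Lemma prod_gface n (i : 'I_n.+1) (g : 'I_n.+2 -> G) :
  (\prod_(j < n.+1) gface i g j)%g = (\prod_(j < n.+2) g j)%g.
Proof.
rewrite -!prod_codom.
elim: n i g => [|n IH] i g; case: (unliftP ord0 i) => [k ->|->].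
- by case: k.
- by rewrite codom_gface0 (codomSSl g) !big_cons mulgA.
- by rewrite codom_gface_lift [in RHS]codomSl !big_cons IH.
- by rewrite codom_gface0 (codomSSl g) !big_cons mulgA.
Qed.

Hypothesis hw : normalized_cocycle w.

(** For i = 0 this is the cocycle identity at p, g_0, g_1; moving i to the right
only changes the starting point p. *)
Lemma path_cocycle_gface p n (i : 'I_n.+1) (g : 'I_n.+2 -> G) :
  path_cocycle p (codom g) =
  w (g (widen_ord (leqnSn _) i)) (g (lift ord0 i))
  + path_cocycle p (codom (gface i g)).
Proof.
have base q m (k : 'I_m.+2 -> G) : path_cocycle q (codom k) =
    w (k (widen_ord (leqnSn _) ord0)) (k (lift ord0 ord0))
    + path_cocycle q (codom (gface ord0 k)).
  rewrite codom_gface0 (codomSSl k) /= !addrA !mulgA -(cocycleE hw).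
  by congr (w (k _) _ + _ + _); apply/val_inj.
elim: n p i g => [|n IH] p i g; case: (unliftP ord0 i) => [k ->|->] //.
  by case: k.
rewrite codom_gface_lift [in LHS]codomSl /= (IH _ k) addrCA.
by congr (w (g _) _ + _); apply/val_inj.
Qed.

Lemma exponent_gface n (i : 'I_n.+1) (g : 'I_n.+2 -> G) :
  exponent g = w (g (widen_ord (leqnSn _) i)) (g (lift ord0 i))
               + exponent (gface i g).
Proof.
by rewrite /exponent (path_cocycle_gface _ i) prod_gface addrA.
Qed.

(** By the cocycle identity at (h, p, g), one letter g changes both sides by the
same amount up to w(h, p g) - w(h, p), and these differences telescope. *)
Lemma path_cocycle_mull h p s : path_cocycle (h * p)%g s =
  path_cocycle p s + w h (p * \prod_(k <- s) k)%g - w h p.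
Proof.
elim: s p => [|g s IH] p /=; first by rewrite big_nil mulg1 add0r subrr.
have -> : w (h * p)%g g = w p g + w h (p * g)%g - w h p.
  by rewrite (cocycleE hw) addrC addKr.
rewrite -mulgA IH big_cons mulgA [_ + _ - w h p]addrAC.
by rewrite [X in _ + X]addrC addrA addrK addrAC addrA.
Qed.

Lemma path_cocycle_rcons p s g :
  path_cocycle p (rcons s g) =
  path_cocycle p s + w (p * \prod_(k <- s) k)%g g.
Proof.
elim: s p => [|h s IH] p /=; first by rewrite big_nil mulg1 addrC.
by rewrite IH big_cons mulgA addrA.
Qed.

Lemma comp_ord_predE n (T : Type) (a : 'I_n.+1 -> T) :
  (a \o @ord_pred n.+1) ord0 = a ord_max /\
  a \o @ord_pred n.+1 \o lift ord0 = a \o widen_ord (leqnSn n).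
Proof.
split=> /=.
  by congr a; apply/val_inj; rewrite /= modn_small.
apply/funext => j /=; congr a; apply/val_inj => /=.
by rewrite add0n modnDr modn_small // ltnW// ltnS.
Qed.

Lemma prod_rot n (g : 'I_n.+1 -> G) :
  (\prod_i (g \o @ord_pred n.+1) i =
   g ord_max * \prod_i g (widen_ord (leqnSn n) i))%g.
Proof.
have [r0 rS] := comp_ord_predE g.
by rewrite big_ord_recl r0; congr (_ * _)%g; apply: eq_bigr => i _;
  rewrite -[RHS]/((g \o widen_ord (leqnSn n)) i) -rS.
Qed.

(** With h the last entry and p the product of the others, moving h to the front
replaces the term w(p, h) by w(h, p), and xi(p h) by xi(h p). *)
Lemma exponent_rot n (g : 'I_n.+1 -> G) x :
  (forall g h, Ad x (g * h)%g -> w g h + xi (g * h)%g = w h g + xi (h * g)%g) ->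
  Ad x (\prod_i g i)%g -> exponent (g \o @ord_pred n.+1) = exponent g.
Proof.
move=> hxi; rewrite /exponent prod_rot codomSl codomSr.
have [-> ->] := comp_ord_predE g; rewrite big_ord_recr /=.
set h := g ord_max; set p := (\prod_i _)%g => /hxi hp.
rewrite (cocycle1g hw) add0r mul1g -[h in path_cocycle h]mulg1.
rewrite path_cocycle_mull path_cocycle_rcons (cocycleg1 hw) subr0 mul1g.
by rewrite !prod_codom -addrA -/p -hp addrA.
Qed.

Lemma Ad_mulC (x g h : G) : Ad x (g * h)%g -> Ad x (h * g)%g.
Proof.
case=> k _ gh; exists (k * g)%g => //.
by rewrite conjgM gh conjgE !mulgA mulVg mul1g.
Qed.

Lemma Ad_rot n (g : 'I_n.+1 -> G) x :
  Ad x (\prod_i (g \o @ord_pred n.+1) i)%g <-> Ad x (\prod_i g i)%g.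
Proof. by rewrite prod_rot big_ord_recr; split; exact: Ad_mulC. Qed.

End Exponent.

(** The product defining the weight starts at w(g_0, g_1); the sum has the
additional term w(1, g_0), which vanishes. *)
Lemma deform_weightE (R : realType) (G : groupType) (w : G -> G -> R[i])
    (hw : normalized_cocycle w) (t : R) (xi : G -> R[i]) n
    (g : 'I_n.+1 -> G) :
  deform_weight w t xi g = cexp (t%:C%C * exponent w xi g).
Proof.
rewrite /deform_weight /exponent path_cocycle_sum.
rewrite [\sum_(i < n.+1) _]big_ord_recl [X in w (_ * X)%g]big_pred0//.
rewrite mulg1 (cocycle1g hw) add0r mulrDr cexpD; congr (_ * _).
rewrite mulr_sumr (big_morph (@cexp R) (@cexpD R) (@cexp0 R)).
by apply: eq_bigr => i _; rewrite /expcocycle mul1g.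
Qed.

(** * Multilinear functionals and the Hochschild coboundary *)

Section Multilinear.
Context (G : groupType) (K : fieldType) (A : gradedAlgType G K).

(** Multilinearity for tuples that agree away from one entry only up to
provable, not definitional, equality; this is what faces and rotations of
updated tuples require. *)
Lemma multilinear_at m (phi : ('I_m -> A) -> K) (a b b' : 'I_m -> A) k c :
  multilinear phi ->
  (forall j, j != k -> b j = a j /\ b' j = a j) ->
  a k = c *: b k + b' k -> phi a = c * phi b + phi b'.
Proof.
move=> lin ab ak.
have upd (d : 'I_m -> A) : (forall j, j != k -> d j = a j) ->
    d = [eta a with k |-> d k] :> ('I_m -> A).
  by move=> da; apply/funext => j /=; case: eqVneq => [->//|/da].
rewrite [X in phi X = _](upd a)// ak lin -!upd// => j jk.
  by have [] := ab j jk.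
by have [] := ab j jk.
Qed.

Lemma multilinear_eq0 m (phi : ('I_m -> A) -> K) (a : 'I_m -> A) k :
  multilinear phi -> a k = 0 -> phi a = 0.
Proof.
move=> lin ak; rewrite (@multilinear_at _ phi a a a k (-1) lin) //.
  by rewrite mulN1r addNr.
by rewrite ak scaler0 addr0.
Qed.

Lemma multilinear_scale m (phi : ('I_m -> A) -> K) (a b : 'I_m -> A) k c :
  multilinear phi -> (forall j, j != k -> a j = b j) -> a k = c *: b k ->
  phi a = c * phi b.
Proof.
move=> lin ab ak.
pose z : 'I_m -> A := [eta b with k |-> 0].
rewrite (@multilinear_at _ phi a b z k c lin).
- by rewrite (@multilinear_eq0 _ phi z k lin) ?addr0 // /z /= eqxx.
- by move=> j jk; rewrite /z /= (negPf jk) ab.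
- by rewrite /z /= eqxx addr0.
Qed.

Lemma multilinear_lin m (phi psi : ('I_m -> A) -> K) (c d : K) :
  multilinear phi -> multilinear psi ->
  multilinear (fun a => c * phi a + d * psi a).
Proof. by move=> lphi lpsi a i k u v; rewrite lphi lpsi; ring. Qed.

Lemma multilinear_rot n (phi : ('I_n.+1 -> A) -> K) :
  multilinear phi -> multilinear (fun a => phi (a \o @ord_pred n.+1)).
Proof.
move=> lin a i c u v; apply: (multilinear_at (k := ordS i)) => // [j ji|] /=.
  suff /negPf -> : ord_pred j != i by [].
  by apply: contra ji => /eqP <-; rewrite ord_predK.
by rewrite ordSK eqxx.
Qed.

(** The entry k of a occurs in exactly one entry of [face i a]: the entry k if
k <= i, and the entry k - 1 otherwise. *)
Lemma multilinear_face n (i : 'I_n.+1) (phi : ('I_n.+1 -> A) -> K) :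
  multilinear phi -> multilinear (fun a => phi (face i a)).
Proof.
move=> lin a k c u v.
have wl (j j' : 'I_n.+1) :
    (widen_ord (leqnSn _) j == lift ord0 j') = (j == j'.+1 :> nat).
  by rewrite -val_eqE.
have ww (j j' : 'I_n.+1) :
    (widen_ord (leqnSn _) j == widen_ord (leqnSn _) j') = (j == j').
  by rewrite -!val_eqE.
(* If k <= i, then k is not the last index, and k' is k in the smaller type. *)
have [ki|ik] := leqP k i.
  have kn : (k < n.+1)%N by apply: leq_ltn_trans ki _.
  pose k' := Ordinal kn; have kE : k = widen_ord (leqnSn _) k'.
    exact/val_inj.
  apply: (multilinear_at (k := k')) => // [j jk|]; rewrite /face kE /=.
    rewrite !ww (negPf jk).
    have k'j : (i <= j)%N -> lift ord0 j != widen_ord (leqnSn n.+1) k'.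
      by move=> ij; rewrite eq_sym wl neq_ltn ltnS (leq_trans ki ij).
    have [//|ij] := ltnP j i; rewrite (negPf (k'j ij)).
    case: (j =P i) jk k'j => // -> jk /(_ (leqnn i))/negPf ->.
    by rewrite (negPf jk).
  rewrite !ww eqxx; case: ifP => // /negbT; rewrite -leqNgt => ik.
  have -> : k' = i by apply/val_inj/eqP; rewrite eqn_leq ki ik.
  rewrite eqxx.
  suff /negPf -> : lift ord0 i != widen_ord (leqnSn n.+1) i.
    by rewrite amul_linl.
  by rewrite eq_sym wl neq_ltn ltnS leqnn.
(* If i < k, then k = k' + 1 and the affected entry is k'. *)
case: (unliftP ord0 k) ik => [k' ->|->] //; rewrite lift0 ltnS => ik.
apply: (multilinear_at (k := k')) => // [j jk|]; rewrite /face /=.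
  rewrite !wl !(inj_eq lift_inj) (negPf jk).
  have [ji|//] := ltnP j i.
    by rewrite ltn_eqF// ltnS (leq_trans (ltnW ji)).
  by case: (j =P i) jk => // -> jk; rewrite (negPf jk) ltn_eqF// ltnS.
rewrite !wl !(inj_eq lift_inj) eqxx ltnNge ik /=.
rewrite [i == k']eq_sym; case: eqP => // ->.
by rewrite ltn_eqF// amul_linr.
Qed.

Lemma last_faceE n (a : 'I_n.+2 -> A) :
  last_face a = face ord0 (a \o @ord_pred n.+2).
Proof.
have [a0 aS] := comp_ord_predE a.
apply/funext => j; rewrite /last_face /face ltn0.
have w0 : widen_ord (leqnSn n.+1) ord0 = ord0 by apply/val_inj.
have aSE i : (a \o @ord_pred n.+2) (lift ord0 i) = a (widen_ord (leqnSn _) i).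
  by rewrite -[RHS]/((a \o widen_ord (leqnSn n.+1)) i) -aS.
by rewrite w0 a0 !aSE w0.
Qed.

Lemma homog_face n (i : 'I_n.+1) (g : 'I_n.+2 -> G) (a : 'I_n.+2 -> A) :
  (forall j, homog (g j) (a j)) -> forall j, homog (gface i g j) (face i a j).
Proof.
move=> ga j; rewrite /gface /face; case: ifP => // _.
by case: ifP => // _; exact: homogM.
Qed.

Lemma hochschild_multilinear n (phi : ('I_n.+1 -> A) -> K^o) :
  multilinear phi -> multilinear (hochschild phi).
Proof.
move=> lin a k c u v; rewrite /hochschild !last_faceE.
rewrite (multilinear_rot (multilinear_face ord0 lin)).
under eq_bigr => i _ do rewrite (multilinear_face i lin) mulrDr mulrCA.
by rewrite big_split -mulr_sumr /=; ring.
Qed.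

Lemma hochschild_supported (x : G) n (phi : ('I_n.+1 -> A) -> K^o) :
  supported x phi -> supported x (hochschild phi).
Proof.
move=> sp g a ga gx; rewrite /hochschild last_faceE.
rewrite big1 => [|i _].
  rewrite (sp _ _ (homog_face ord0 (fun j => ga (ord_pred j)))) ?mulr0 ?addr0//.
  by rewrite (prod_gface ord0 (g \o @ord_pred n.+2)) Ad_rot.
by rewrite (sp _ _ (homog_face i ga)) ?mulr0// prod_gface.
Qed.

(** The multilinear functional that equals c(g) phi(a) on tuples a that are
homogeneous of degrees g, obtained by expanding every entry into its homogeneous
components.  Only finitely many terms are nonzero ([reweight_fin]). *)
Definition reweight m (c : ('I_m -> G) -> K) (phi : ('I_m -> A) -> K)
    (a : 'I_m -> A) : K :=
  \sum_(g \in [set: {ffun 'I_m -> G}]%classic)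
    c g * phi (fun i => hcomp (a i) (g i)).

(** All entries have their degrees in one finite set X, and there are finitely
many functions from a finite index set to X. *)
Lemma finite_degrees m (a : 'I_m -> A) :
  finite_set
    [set g : {ffun 'I_m -> G} | forall i, hcomp (a i) (g i) != 0]%classic.
Proof.
have : finite_set
    (\bigcup_(i in [set: 'I_m]) [set h | hcomp (a i) h != 0])%classic.
  by apply: bigcup_finite => // i _; have [] := hcompP (a i).
move=> /finite_fsetP[X XE].
pose incl (f : {ffun 'I_m -> X}) : {ffun 'I_m -> G} := [ffun i => val (f i)].
apply: (@sub_finite_set _ _ (incl @` [set: {ffun 'I_m -> X}])%classic).
  move=> g /= ga.
  have gX i : g i \in X.
    by have /seteqP[sub _] := XE; apply: sub; exists i => //=.
  exists [ffun i => [` gX i]%fset] => //.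
  by apply/ffunP => i; rewrite !ffunE.
exact/finite_image/finite_finset.
Qed.

Lemma reweight_fin m c (phi : ('I_m -> A) -> K) (a : 'I_m -> A) :
  multilinear phi ->
  finite_set [set g : {ffun 'I_m -> G} |
    c g * phi (fun i => hcomp (a i) (g i)) != 0]%classic.
Proof.
move=> lin; apply: sub_finite_set (finite_degrees a) => g /= /eqP ag i.
apply/eqP => gi0; apply: ag.
by rewrite (@multilinear_eq0 _ phi _ i lin) ?mulr0.
Qed.

Lemma fsumr_lin (I : choiceType) (c : K) (F F' : I -> K) :
  finite_set [set i | F i != 0]%classic ->
  finite_set [set i | F' i != 0]%classic ->
  \sum_(i \in [set: I]%classic) (c * F i + F' i) =
  c * (\sum_(i \in [set: I]%classic) F i) + \sum_(i \in [set: I]%classic) F' i.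
Proof.
move=> /finite_fsetP[s sE] /finite_fsetP[s' sE'].
have sub i : i \notin (s `|` s')%fset -> F i = 0 /\ F' i = 0.
  rewrite in_fsetU negb_or => /andP[si s'i]; split; apply/eqP.
  - apply: contraNT si => Fi; have /seteqP[+ _] := sE; exact.
  - apply: contraNT s'i => Fi; have /seteqP[+ _] := sE'; exact.
rewrite !(fsbigTE (s `|` s')%fset); try by move=> i /sub[].
  by rewrite big_split/= mulr_sumr.
by move=> i /sub[-> ->]; rewrite mulr0 addr0.
Qed.

Lemma reweight_multilinear m c (phi : ('I_m -> A) -> K) :
  multilinear phi -> multilinear (reweight c phi).
Proof.
move=> lin a k d u v; rewrite /reweight -fsumr_lin; try exact: reweight_fin.
apply: eq_fsbigr => g _.
rewrite mulrCA -mulrDr; congr (_ * _).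
apply: (multilinear_at (k := k)) => // [j jk|] /=.
  by rewrite (negPf jk).
by rewrite eqxx hcomp_lin.
Qed.

Lemma reweight_homog m c (phi : ('I_m -> A) -> K) (g : 'I_m -> G)
    (a : 'I_m -> A) :
  multilinear phi -> (forall i, homog (g i) (a i)) ->
  reweight c phi a = c g * phi a.
Proof.
move=> lin ga; rewrite /reweight (fsbigTE [fset [ffun i => g i]]%fset).
  rewrite big_seq_fset1; congr (c _ * phi _); apply/funext => i.
    by rewrite ffunE.
  by rewrite ffunE (hcomp_homog (ga i)) eqxx.
move=> h; rewrite inE => hg.
have [i hi] : exists i, h i != g i.
  apply/existsP; apply: contraNT hg; rewrite negb_exists => /forallP hg.
  apply/eqP/ffunP => i; rewrite ffunE; apply/eqP.
  by have := hg i; rewrite negbK.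
rewrite (@multilinear_eq0 _ phi _ i lin) ?mulr0//.
by rewrite (hcomp_homog (ga i)) (negPf hi).
Qed.

End Multilinear.

(** * The deformation of cochains *)

Section Deform.
Context (R : realType) (G : groupType) (w : G -> G -> R[i]).
Context (hw : normalized_cocycle w) (xi : G -> R[i]) (x : G).
Hypothesis hxi : forall g h : G, Ad x (g * h)%g ->
  w g h + xi (g * h)%g = w h g + xi (h * g)%g.
Context (A : gradedAlgType G R[i]).

Definition deform (t : R) m (phi : ('I_m.+1 -> A) -> R[i]) :
    ('I_m.+1 -> A) -> R[i] :=
  reweight (fun g => if `[< Ad x (\prod_i g i)%g >]
                     then deform_weight w t xi g else 0) phi.

Lemma deformP t m (phi : ('I_m.+1 -> A) -> R[i]) :
  multilinear phi -> is_deformation w t xi x phi (deform t phi).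
Proof.
move=> lin g a ga; rewrite /deform (reweight_homog _ lin ga).
by case: ifP => // _; rewrite mul0r.
Qed.

Lemma deform_multilinear t m (phi : ('I_m.+1 -> A) -> R[i]) :
  multilinear phi -> multilinear (deform t phi).
Proof. exact: reweight_multilinear. Qed.

(** All identities between deformed functionals are proved by comparing their
values on homogeneous tuples through this characterization. *)
Lemma deform_uniq t m (phi psi : ('I_m.+1 -> A) -> R[i]) :
  multilinear phi -> multilinear psi -> is_deformation w t xi x phi psi ->
  psi = deform t phi.
Proof.
move=> lphi lpsi def; apply: is_deformation_uniq lpsi _ def (deformP t lphi).
exact: deform_multilinear.
Qed.

Lemma deform_lin t m (c : R[i]) (phi psi : ('I_m.+1 -> A) -> R[i]^o) :
  multilinear phi -> multilinear psi ->
  deform t (c *: phi + psi) = c *: (deform t phi : _ -> R[i]^o) + deform t psi.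
Proof.
move=> lphi lpsi.
have lin (f g : ('I_m.+1 -> A) -> R[i]^o) :
    multilinear f -> multilinear g -> multilinear (c *: f + g).
  move=> lf lg; have := multilinear_lin c 1 lf lg.
  by under [X in multilinear X]funext => a do rewrite mul1r.
apply/esym/deform_uniq; first exact: lin.
  by apply: lin; exact: deform_multilinear.
move=> g a ga; rewrite !fctE /GRing.scale/=.
rewrite !(deformP t _ ga)//; case: ifP => _; last by rewrite mulr0 addr0.
by ring.
Qed.

Lemma deform_zero t m : deform t (0 : ('I_m.+1 -> A) -> R[i]^o) = 0.
Proof.
apply/esym/deform_uniq; try by move=> a i c u v; rewrite mulr0 addr0.
by move=> g a ga; rewrite mulr0 if_same.
Qed.

Lemma deform_supported t m (phi : ('I_m.+1 -> A) -> R[i]) :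
  multilinear phi -> supported x (deform t phi).
Proof.
by move=> lin g a ga gx; rewrite (deformP t lin ga); case: asboolP.
Qed.

(** For t = 0 all weights are 1 on the class, so that the deformation only
truncates to the class. *)
Lemma deform_time0 m (phi : ('I_m.+1 -> A) -> R[i]) :
  multilinear phi -> supported x phi -> deform 0 phi = phi.
Proof.
move=> lin sp; apply/esym/deform_uniq => // g a ga.
case: asboolP => [_|/(sp g a ga)] //.
by rewrite (deform_weightE hw) mul0r cexp0 mul1r.
Qed.

Lemma deformD s t m (phi : ('I_m.+1 -> A) -> R[i]) :
  multilinear phi -> deform s (deform t phi) = deform (s + t) phi.
Proof.
move=> lin; have lint := deform_multilinear t lin.
apply: deform_uniq => //; first exact: deform_multilinear.
move=> g a ga; rewrite (deformP s lint ga) (deformP t lin ga).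
case: asboolP => // _; rewrite !(deform_weightE hw) mulrA -cexpD -mulrDl.
by rewrite -raddfD.
Qed.

Lemma deformNK t m (phi : ('I_m.+1 -> A) -> R[i]) :
  multilinear phi -> supported x phi -> deform (- t) (deform t phi) = phi.
Proof. by move=> lin sp; rewrite deformD// addNr deform_time0. Qed.

(** Both sides of the cyclicity equation are deformations of the functional
(-1)^n phi: the rotated one because the exponent is invariant under rotation. *)
Lemma deform_cyclic t n (phi : ('I_n.+1 -> A) -> R[i]) :
  multilinear phi -> cyclic phi -> cyclic (deform t phi).
Proof.
move=> lin cyc a; have lint := deform_multilinear t lin.
have scaled (f : ('I_n.+1 -> A) -> R[i]) :
    multilinear f -> multilinear (fun b => (-1) ^+ n * f b).
  move=> lf; have := multilinear_lin ((-1) ^+ n) 0 lf lf.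
  by under [X in multilinear X]funext => b do rewrite mul0r addr0.
have rotE : (fun b => deform t phi (b \o @ord_pred n.+1)) =
    deform t (fun b => (-1) ^+ n * phi b).
  apply: deform_uniq; [exact: scaled | exact: multilinear_rot |] => g b gb.
  rewrite (deformP t lin (fun i => gb (ord_pred i))) cyc.
  have -> : `[< Ad x (\prod_i (g \o @ord_pred n.+1) i)%g >] =
      `[< Ad x (\prod_i g i)%g >] by apply/asbool_equiv_eq/Ad_rot.
  by case: asboolP => // gx; rewrite !(deform_weightE hw) (exponent_rot hw hxi).
have signE : (fun b => (-1) ^+ n * deform t phi b) =
    deform t (fun b => (-1) ^+ n * phi b).
  apply: deform_uniq; [exact: scaled | exact: scaled |] => g b gb.
  rewrite (deformP t lin gb).
  by case: asboolP => _; [rewrite mulrCA | rewrite mulr0].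
by have /(congr1 (fun f => f a)) := etrans rotE (esym signE).
Qed.

Lemma deform_cochain t n (phi : ('I_n.+1 -> A) -> R[i]^o) :
  cochain x phi -> cochain x (deform t phi).
Proof.
case=> lin cyc sp; split.
- exact: deform_multilinear.
- exact: deform_cyclic.
- exact: deform_supported.
Qed.

(** Entry i of the twisted face is w^t(g_i, g_(i+1)) times that of the untwisted
face, and this factor completes the weight of the degrees of the face to the
weight of g. *)
Lemma deform_face t n (phi : ('I_n.+1 -> A) -> R[i]^o) (i : 'I_n.+1)
    (g : 'I_n.+2 -> G) (a : 'I_n.+2 -> A) :
  multilinear phi -> (forall j, homog (g j) (a j)) ->
  Ad x (\prod_j g j)%g ->
  deform t phi (@face _ _ (twist hw t A) n i a) =
  deform_weight w t xi g * phi (face i a).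
Proof.
move=> lin ga gx.
rewrite (@multilinear_scale _ _ A _ _ _ (face i a) i
  (expcocycle w t (g (widen_ord (leqnSn _) i)) (g (lift ord0 i)))
  (deform_multilinear t lin)).
- rewrite (deformP t lin (homog_face i ga)) prod_gface asboolT//.
  by rewrite !(deform_weightE hw) mulrA -cexpD -mulrDr -exponent_gface.
- by move=> j ji; rewrite /face (negPf ji).
- by rewrite /face ltnn eqxx; apply: twist_mulE.
Qed.

(** Face by face, [deform_face] gives the weight of g.  For the last face, it
gives the weight of the rotated degrees, which is the same on the class. *)
Lemma hochschild_deform t n (phi : ('I_n.+1 -> A) -> R[i]^o) :
  cochain x phi ->
  @hochschild _ _ (twist hw t A) n (deform t phi) = deform t (hochschild phi).
Proof.
move=> cphi; have [lin cyc sp] := cphi.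
have [lint _ spt] := deform_cochain t cphi.
apply: deform_uniq; first exact: hochschild_multilinear.
  exact: (@hochschild_multilinear _ _ (twist hw t A)).
move=> g a ga; case: asboolP => gx; last first.
  exact: (@hochschild_supported _ _ (twist hw t A) x n _ spt g a ga).
rewrite /hochschild !last_faceE.
have gax : Ad x (\prod_j (g \o @ord_pred n.+2) j)%g by rewrite Ad_rot.
rewrite (deform_face t ord0 lin (fun j => ga (ord_pred j)) gax).
rewrite mulrDr mulrCA !(deform_weightE hw) (exponent_rot hw hxi gx).
congr (_ + _); rewrite mulr_sumr; apply: eq_bigr => i _.
by rewrite (deform_face t i lin ga gx) (deform_weightE hw) mulrCA.
Qed.

(** Write psi as the deformation of phi = [deform (- t) psi] and apply
[hochschild_deform] to phi. *)
Lemma hochschild_undeform t n (psi : ('I_n.+1 -> A) -> R[i]^o) :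
  cochain x psi ->
  hochschild (deform (- t) psi) =
  deform (- t) (@hochschild _ _ (twist hw t A) n psi).
Proof.
move=> cpsi; have cphi := deform_cochain (- t) cpsi.
have [lin _ sp] := cpsi; have [lin' _ sp'] := cphi.
rewrite -[in RHS](deformNK (- t) lin sp) opprK hochschild_deform//.
rewrite deformNK//; first exact: hochschild_multilinear.
exact: hochschild_supported.
Qed.

Lemma deform_is_cocycle t n (phi : ('I_n.+1 -> A) -> R[i]^o) :
  phi \in is_cocycle x (n := n) ->
  (deform t phi : ('I_n.+1 -> twist hw t A) -> R[i]^o)
    \in is_cocycle x (n := n).
Proof.
move=> /asboolP[cphi phi0]; apply/asboolP; split; first exact: deform_cochain.
rewrite hochschild_deform// phi0.
exact: deform_zero.
Qed.

Lemma undeform_is_cocycle t n (psi : ('I_n.+1 -> twist hw t A) -> R[i]^o) :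
  psi \in is_cocycle x (n := n) ->
  (deform (- t) psi : ('I_n.+1 -> A) -> R[i]^o) \in is_cocycle x (n := n).
Proof.
move=> /asboolP[cpsi psi0]; apply/asboolP; split; first exact: deform_cochain.
rewrite hochschild_undeform// psi0.
exact: deform_zero.
Qed.

End Deform.

(** * Passage to cohomology *)

Section QuotientMap.
Context (K : pzRingType) (V V' : lmodType K) (S : {pred V}) (S' : {pred V'}).
Context (hS : submod_closed S) (hS' : submod_closed S') (D : V -> V').
Hypothesis D_lin : forall c u v, D (c *: u + v) = c *: D u + D v.
Hypothesis D_sub : forall u, u \in S -> D u \in S'.

Definition quot_map (u : lmod_quot hS) : lmod_quot hS' :=
  \pi_(lmod_quot hS') (D (repr u)).

Lemma quot_mapE v : quot_map (\pi_(lmod_quot hS) v) = \pi_(lmod_quot hS') (D v).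
Proof.
have DB u u' : D (u - u') = D u - D u'.
  by rewrite addrC -scaleN1r D_lin scaleN1r addrC.
apply/eqP; rewrite /quot_map -Quotient.idealrBE -DB; apply: D_sub.
by rewrite -[_ \in S]/(_ \in submodule hS) Quotient.idealrBE reprK.
Qed.

Lemma quot_map_linear : linear quot_map.
Proof.
move=> c; elim/quotW => u; elim/quotW => v.
have pi_lin (W : lmodType K) (T : {pred W}) (hT : submod_closed T) (p q : W) :
    \pi_(lmod_quot hT) (c *: p + q) =
    c *: \pi_(lmod_quot hT) p + \pi_(lmod_quot hT) q.
  rewrite -[c *: \pi_(lmod_quot hT) p]/(quot_scale c _) -(pi_scale hT) -raddfD.
  by [].
by rewrite -pi_lin !quot_mapE D_lin pi_lin.
Qed.

HB.instance Definition _ := GRing.isLinear.Build K (lmod_quot hS)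
  (lmod_quot hS') *:%R quot_map quot_map_linear.

Definition quot_map_lin : {linear lmod_quot hS -> lmod_quot hS'} := quot_map.

End QuotientMap.

Lemma cocycle_cochain (G : groupType) (K : fieldType) (A : gradedAlgType G K)
    (x : G) n (phi : cocycle A x n) : cochain x phi.
Proof. by have /asboolP[] := valP phi. Qed.

Section DeformCohomology.
Context (R : realType) (G : groupType) (w : G -> G -> R[i]).
Context (hw : normalized_cocycle w) (xi : G -> R[i]) (x : G).
Hypothesis hxi : forall g h : G, Ad x (g * h)%g ->
  w g h + xi (g * h)%g = w h g + xi (h * g)%g.
Context (A : gradedAlgType G R[i]) (t : R) (n : nat).
Local Notation B := (twist hw t A).

Definition deform_cocycle (phi : cocycle A x n) : cocycle B x n :=
  Cocycle (deform_is_cocycle hw hxi t (valP phi)).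

Definition undeform_cocycle (psi : cocycle B x n) : cocycle A x n :=
  Cocycle (undeform_is_cocycle hxi (valP psi)).

Lemma deform_cocycle_lin c (u v : cocycle A x n) :
  deform_cocycle (c *: u + v) = c *: deform_cocycle u + deform_cocycle v.
Proof.
have [lu _ _] := cocycle_cochain u; have [lv _ _] := cocycle_cochain v.
by apply/val_inj; rewrite /= deform_lin.
Qed.

Lemma undeform_cocycle_lin c (u v : cocycle B x n) :
  undeform_cocycle (c *: u + v) = c *: undeform_cocycle u + undeform_cocycle v.
Proof.
have [lu _ _] := cocycle_cochain u; have [lv _ _] := cocycle_cochain v.
by apply/val_inj; rewrite /= (@deform_lin R G w xi x A).
Qed.

Lemma deform_cocycleK : cancel deform_cocycle undeform_cocycle.
Proof.
move=> u; have [lu _ su] := cocycle_cochain u.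
by apply/val_inj; rewrite /= deformNK.
Qed.

Lemma undeform_cocycleK : cancel undeform_cocycle deform_cocycle.
Proof.
move=> u; have [lu _ su] := cocycle_cochain u.
apply/val_inj => /=.
by have := @deformNK R G w hw xi x A (- t) n u lu su; rewrite opprK.
Qed.

Lemma deform_coboundary (u : cocycle A x n) :
  u \in coboundary (n := n) -> deform_cocycle u \in coboundary (n := n).
Proof.
move=> /asboolP cu; apply/asboolP; move: cu; rewrite /deform_cocycle /=.
case: n u => [|m] u /= => [->|[psi cpsi upsi]]; first exact: deform_zero.
exists (deform w xi x t psi : ('I_m.+1 -> B) -> R[i]^o).
  exact: (deform_cochain hw hxi).
by rewrite upsi hochschild_deform.
Qed.

Lemma undeform_coboundary (u : cocycle B x n) :
  u \in coboundary (n := n) -> undeform_cocycle u \in coboundary (n := n).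
Proof.
move=> /asboolP cu; apply/asboolP; move: cu; rewrite /undeform_cocycle /=.
case: n u => [|m] u /= => [->|[psi cpsi upsi]]; first exact: deform_zero.
exists (deform w xi x (- t) psi : ('I_m.+1 -> A) -> R[i]^o).
  exact: (deform_cochain hw hxi).
by rewrite upsi (hochschild_undeform hw hxi).
Qed.

Definition deform_HC : {linear HC A x n -> HC B x n} :=
  quot_map_lin (coboundary_submod A x n) (coboundary_submod B x n)
    deform_cocycle_lin deform_coboundary.

Lemma deform_HCE phi : deform_HC (HC_class phi) = HC_class (deform_cocycle phi).
Proof. exact: (quot_mapE _ _ deform_cocycle_lin deform_coboundary). Qed.

Lemma deform_HC_bij : bijective deform_HC.
Proof.
have [undeform undeformE] : exists undeform : HC B x n -> HC A x n,
    forall psi, undeform (HC_class psi) = HC_class (undeform_cocycle psi).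
  exists (quot_map (coboundary_submod A x n) undeform_cocycle) => psi.
  exact: (quot_mapE _ _ undeform_cocycle_lin undeform_coboundary).
exists undeform.
  elim/quotW => u; rewrite -[\pi_ _ u]/(HC_class u).
  by rewrite deform_HCE undeformE deform_cocycleK.
elim/quotW => u; rewrite -[\pi_ _ u]/(HC_class u).
rewrite undeformE deform_HCE.
exact: (congr1 (@HC_class G R[i] B x n) (undeform_cocycleK u)).
Qed.

End DeformCohomology.

(** * The isomorphism *)

Theorem mainTheorem4 (R : realType) (G : groupType)
    (w0 : G -> G -> R[i]) (hw : normalized_cocycle w0)
    (t : R) (ht : 0 <= t <= 1)
    (x : G) (hx : finite_order x)
    (xi : G -> R[i])
    (hxi : forall g h : G, Ad x (g * h)%g ->
       w0 g h + xi (g * h)%g = w0 h g + xi (h * g)%g)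
    (A : gradedAlgType G R[i]) (n : nat) :
  exists f : {linear HC A x n -> HC (twist hw t A) x n},
    bijective f /\
    forall phi : cocycle A x n,
      exists psi : cocycle (twist hw t A) x n,
        is_deformation w0 t xi x phi psi /\
        f (HC_class phi) = HC_class psi.
Proof.
exists (deform_HC hw hxi A t n); split; first exact: deform_HC_bij.
move=> phi; exists (deform_cocycle hw hxi t phi); split.
  by apply: deformP; have [] := cocycle_cochain phi.
exact: deform_HCE.
Qed.
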